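(* Let $G=\operatorname{GL}_2(q)$, where $q$ is a prime power. Let $\mu,\nu:\mathbb{F}_q^\times\to\mathbb{C}^\times$ be multiplicative characters satisfying $\mu(\sigma)=\varepsilon^m$ and $\nu(\sigma)=\varepsilon^n$ for a generator $\sigma$ of $\mathbb{F}_q^\times$, where $0\le n<m\le q-2$ and $\varepsilon$ is a primitive $(q-1)$-th root of unity in $\mathbb{C}$. Let $\chi=\chi_{q+1}^{(m,n)}$ be the principal series character afforded by $\pi_{\mu,\nu}=\operatorname{Ind}_B^G(\mu\otimes\nu)$, where $B$ denotes the Borel subgroup of upper triangular matrices of $G$. Define $d=\gcd(m,n,q-1)$ and $M=\frac{q-1}{d}$. Let $\rho_B$ be an irreducible $\mathbb{Q}$-representation of $B$ affording the character $\Omega(\mu\otimes\nu)$, and set $\Pi_{\mu,\nu}=\operatorname{Ind}_B^G(\rho_B)$. Then the following hold. (1) If $\left(\frac{m}{d}\right)^2\not\equiv\left(\frac{n}{d}\right)^2\pmod M$, then $\Pi_{\mu,\nu}$ is an irreducible $\mathbb{Q}$-representation of $G$ with character $\Omega(\chi)$. (2) If $\left(\frac{m}{d}\right)^2\equiv\left(\frac{n}{d}\right)^2\pmod M$, then $\Pi_{\mu,\nu}\cong\mathcal{R}\oplus\mathcal{R}$, where $\mathcal{R}$ is an irreducible $\mathbb{Q}$-representation of $G$ that affords the character $\Omega(\chi)$. In particular, $\Pi_{\mu,\nu}$ is the direct sum of two isomorphic irreducible $\mathbb{Q}$-representations of $G$ with character $\Omega(\chi)$.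
   Context: For a finite group $H$ and an irreducible complex character $\psi$ of $H$, $\mathbb{Q}(\psi)$ is the field generated over $\mathbb{Q}$ by the values of $\psi$, $m_{\mathbb{Q}}(\psi)$ is the Schur index of $\psi$ over $\mathbb{Q}$, and $$\Omega(\psi)=m_{\mathbb{Q}}(\psi)\sum_{\tau\in\operatorname{Gal}(\mathbb{Q}(\psi)/\mathbb{Q})}\psi^{\tau},\qquad \psi^\tau(h)=\tau(\psi(h)).$$ The one-dimensional representation $\mu\otimes\nu$ of $B$ is defined by $(\mu\otimes\nu)\begin{pmatrix}a&b\\0&d\end{pmatrix}=\mu(a)\nu(d)$ for $a,d\in\mathbb{F}_q^\times$, $b\in\mathbb{F}_q$. Since $\mu\ne\nu$, the induced representation $\pi_{\mu,\nu}$ (of dimension $q+1$) is irreducible over $\mathbb{C}$. *)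

(* Defs.v *)
From HB Require Import structures.
From mathcomp Require Import all_boot all_order all_algebra all_fingroup.
From mathcomp Require Import all_solvable all_field all_character.
From mathcomp Require classical_sets.

Set Implicit Arguments.
Unset Strict Implicit.
Unset Printing Implicit Defensive.

Import GroupScope GRing.Theory.
Local Open Scope ring_scope.

(* The field of complex numbers is represented by algC, over which MathComp    *)
(* defines characters; no generality is lost, as the values of the characters  *)
(* of a finite group are algebraic.                                            *)

Section Induction.

Variables (K : fieldType) (gT : finGroupType) (G H : {group gT}) (n : nat).
Hypothesis sHG : H \subset G.
Variable rH : mx_representation K H n.

Definition rcoset_rep (i : 'I_#|rcosets H G|) : gT := repr (enum_val i).

Lemma rcoset_repP i :
  rcoset_rep i \in G /\ enum_val i = (H :* rcoset_rep i)%g.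
Proof.
have /rcosetsP[x Gx eqx] := enum_valP i.
have: rcoset_rep i \in (H :* x)%g by rewrite /rcoset_rep eqx mem_repr_rcoset.
move=> /rcosetP[h Hh def_t]; split; last by rewrite def_t rcosetM rcoset_id.
by rewrite def_t groupM // (subsetP sHG).
Qed.

Lemma rcoset_rep_eq i j :
  ((rcoset_rep i * (rcoset_rep j)^-1)%g \in H) = (i == j).
Proof.
apply/idP/eqP => [|->]; last by rewrite mulgV group1.
rewrite -mem_rcoset => /rcoset_eqP.
by have [_ <-] := rcoset_repP i; have [_ <-] := rcoset_repP j => /enum_val_inj.
Qed.

Lemma rcoset_rep_exists g :
  g \in G -> exists j, (g * (rcoset_rep j)^-1)%g \in H.
Proof.
move=> Gg; have HgG : (H :* g)%g \in rcosets H G by rewrite mem_rcosets mulSGid.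
exists (enum_rank_in HgG (H :* g)%g).
set j := enum_rank_in _ _; have [_] := rcoset_repP j.
by rewrite /j enum_rankK_in // -mem_rcoset => <-; apply: rcoset_refl.
Qed.

(* MathComp representations act on row vectors, on the right. For the          *)
(* representatives t_i of the right cosets H t_i, the block (i, j) of g is     *)
(* nonzero only when t_i g = h t_j with h in H, and is then the matrix of h.   *)
Definition induced_mx (g : gT) :
    'M[K]_(\sum_(i < #|rcosets H G|) n)%N :=
  \mxblock_(i < #|rcosets H G|, j < #|rcosets H G|)
    (let h := (rcoset_rep i * g * (rcoset_rep j)^-1)%g in
     if h \in H then rH h else 0).

Lemma induced_mx_repr : mx_repr G induced_mx.
Proof.
split=> [|x y Gx Gy].
  rewrite -mxdiagZ; apply/eq_mxblock => i j /=; rewrite mulg1 rcoset_rep_eq.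
  case: eqVneq => [->|//].
  by rewrite mulgV repr_mx1 conform_mx_id.
rewrite mul_mxblock; apply/eq_mxblock => i k /=.
have [Gi _] := rcoset_repP i.
have [j Hj] := rcoset_rep_exists (groupM Gi Gx).
rewrite (bigD1 j) //= Hj big1 ?addr0 => [|l /negPf neq_lj]; last first.
  case: ifP => [Hl|]; last by rewrite mul0mx.
  have := groupM (groupVr Hj) Hl.
  by rewrite invMg invgK mulgA mulgKV rcoset_rep_eq eq_sym neq_lj.
have -> : (rcoset_rep i * (x * y) * (rcoset_rep k)^-1
  = (rcoset_rep i * x * (rcoset_rep j)^-1)
    * (rcoset_rep j * y * (rcoset_rep k)^-1))%g by rewrite !mulgA mulgKV.
rewrite groupMl //; case: ifP => Hk; last by rewrite mulmx0.
by rewrite repr_mxM.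
Qed.

Definition induced_repr := MxRepresentation induced_mx_repr.

End Induction.

Section RationalCharacters.

Variables (gT : finGroupType) (G : {group gT}).

Section CharacterField.

Variables (L : fieldExtType rat) (iota : {rmorphism L -> algC}).

(* The inverse of the embedding iota, extended by 0 outside its image.         *)
Definition preim_emb (z : algC) : L :=
  classical_sets.xget 0 (fun x => iota x = z).

Lemma iotaK : cancel iota preim_emb.
Proof.
move=> x; rewrite /preim_emb.
by case: classical_sets.xgetP => [y _ /fmorph_inj|/(_ x)].
Qed.

(* Q(psi), inside a number field L that contains the values of psi.            *)
Definition char_field (psi : 'CF(G)) : {subfield L} :=
  <<1 & [seq preim_emb (psi g) | g in G]>>%AS.

End CharacterField.

(* psi is afforded by a representation over some number field L of degree k    *)
(* over Q(psi); such an L contains Q(psi), as the values of psi are traces.    *)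
Definition realizable_in_degree (psi : 'CF(G)) (k : nat) : Prop :=
  exists (L : fieldExtType rat) (iota : {rmorphism L -> algC})
         (n : nat) (rG : mx_representation L G n),
    cfRepr (map_repr iota rG) = psi
    /\ k = \dim_(char_field iota psi) {:L}%VS.

Definition is_schur_index (psi : 'CF(G)) (m : nat) : Prop :=
  realizable_in_degree psi m /\
  forall k, realizable_in_degree psi k -> (m <= k)%N.

(* Every character is realizable over a number field, so the default value 0   *)
(* only concerns class functions that are not characters.                      *)
Definition schur_index (psi : 'CF(G)) : nat :=
  classical_sets.xget 0%N (is_schur_index psi).

Lemma group_splitting_field_exists :
  {Qn : splittingFieldType rat & {QnC : {rmorphism Qn -> algC} |
     forall phi : 'CF(G), phi \is a character ->
       forall g, exists a, QnC a = phi g}}.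
Proof.
have [Qn _ [QnC _ [_ _ QnP]]] := group_num_field_exists G.
exists Qn, QnC => phi Nphi g; have [Gg | notGg] := boolP (g \in G).
  by have [a <-] := QnP _ _ _ Nphi g (order_dvdG Gg); exists a.
by exists 0; rewrite rmorph0 cfun0.
Qed.

(* A number field, normal over Q, that contains all the character values of G. *)
Definition group_field : splittingFieldType rat :=
  projT1 group_splitting_field_exists.

Definition group_field_emb : {rmorphism group_field -> algC} :=
  sval (projT2 group_splitting_field_exists).

Lemma group_field_embP (phi : 'CF(G)) : phi \is a character ->
  forall g, group_field_emb (preim_emb group_field_emb (phi g)) = phi g.
Proof.
move=> Nphi g.
by have [a <-] := svalP (projT2 group_splitting_field_exists) phi Nphi g;
   rewrite iotaK.
Qed.

Section GaloisConjugate.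

Variables (psi : 'CF(G)) (tau : gal_of (char_field group_field_emb psi)).

Definition gal_conj_val (z : algC) : algC :=
  group_field_emb (tau (preim_emb group_field_emb z)).

Lemma gal_conj_val0 : gal_conj_val 0 = 0.
Proof.
by rewrite /gal_conj_val -[X in preim_emb _ X](rmorph0 group_field_emb) iotaK
           !rmorph0.
Qed.

(* g |-> tau (psi g)                                                           *)
Definition gal_conj : 'CF(G) := cfun_comp gal_conj_val0 psi.

End GaloisConjugate.

Definition Omega (psi : 'CF(G)) : 'CF(G) :=
  (schur_index psi)%:R *:
    \sum_(tau in 'Gal(char_field group_field_emb psi / 1)) gal_conj tau.

Definition affords_rat n (rG : mx_representation rat G n) (psi : 'CF(G)) :=
  cfRepr (map_repr ratr rG) = psi.

End RationalCharacters.

Section Borel.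

Variable F : finFieldType.

(* The entries of x : {'GL_2[F]} are indexed by 'I_2.-1.+1.                    *)
Definition borel_set : {set {'GL_2[F]}} :=
  [set x : {'GL_2[F]} | GLval x ord_max ord0 == 0].

Lemma GL2_mulE (x y : {'GL_2[F]}) i j :
  GLval (x * y)%g i j =
    GLval x i ord0 * GLval y ord0 j + GLval x i ord_max * GLval y ord_max j.
Proof.
rewrite GL_ME mxE big_ord_recl big_ord1.
by congr (_ + _ * _); congr (GLval _ _ _); apply: val_inj.
Qed.

Lemma borel_group_set : group_set borel_set.
Proof.
apply/group_setP; split=> [|x y]; first by rewrite inE GL_1E mxE.
by rewrite !inE GL2_mulE => /eqP-> /eqP->; rewrite mul0r mulr0 addr0.
Qed.
Canonical borel : {group {'GL_2[F]}} := Group borel_group_set.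

(* The diagonal entry x_ii as a unit of F (1 if it is 0, which never happens   *)
(* for x in the Borel subgroup).                                               *)
Definition diag_unit (x : {'GL_2[F]}) i : {unit F} :=
  insubd (1%g : {unit F}) (GLval x i i).

Lemma borel_diag_neq0 (x : {'GL_2[F]}) i : x \in borel -> GLval x i i != 0.
Proof.
rewrite inE => /eqP x10.
have: GLval (x^-1 * x)%g ord0 ord0 = 1 by rewrite mulVg GL_1E mxE.
have: GLval (x * x^-1)%g ord_max ord_max = 1 by rewrite mulgV GL_1E mxE.
rewrite !GL2_mulE x10 mul0r mulr0 addr0 add0r => x11 x00.
have oner := oner_neq0 F; case: i => [[|[|//]] lti].
  rewrite (_ : Ordinal lti = ord0); last exact: val_inj.
  by apply: contraNneq oner => x0; rewrite -x00 x0 mulr0.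
rewrite (_ : Ordinal lti = ord_max); last exact: val_inj.
by apply: contraNneq oner => x1; rewrite -x11 x1 mul0r.
Qed.

Lemma diag_unitK x i : x \in borel -> val (diag_unit x i) = GLval x i i.
Proof. by move=> Bx; rewrite insubdK // unfold_in unitfE borel_diag_neq0. Qed.

Lemma diag_unitM i :
  {in borel &, {morph diag_unit^~ i : x y / (x * y)%g}}.
Proof.
move=> x y Bx By; apply: val_inj; rewrite FinRing.val_unitM.
rewrite !diag_unitK ?groupM // GL2_mulE.
move: Bx By; rewrite !inE => /eqP x10 /eqP y10.
case: i => [[|[|//]] lti].
  rewrite (_ : Ordinal lti = ord0); last exact: val_inj.
  by rewrite y10 mulr0 addr0.
rewrite (_ : Ordinal lti = ord_max); last exact: val_inj.
by rewrite x10 mul0r add0r.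
Qed.

Section TensorCharacter.

Variables mu nu : 'CF([set: {unit F}]).
Hypotheses (lin_mu : mu \is a linear_char) (lin_nu : nu \is a linear_char).

Definition borel_tensor_mx (x : {'GL_2[F]}) : 'M[algC]_1 :=
  (mu (diag_unit x ord0) * nu (diag_unit x ord_max))%:M.

Lemma borel_tensor_mx_repr : mx_repr borel borel_tensor_mx.
Proof.
split=> [|x y Bx By].
  have diag1 i : diag_unit 1 i = 1%g.
    by apply: val_inj; rewrite diag_unitK ?group1 // GL_1E mxE eqxx.
  by rewrite /borel_tensor_mx !diag1 !lin_char1 // mulr1.
rewrite /borel_tensor_mx -scalar_mxM !diag_unitM // !lin_charM ?inE //.
by rewrite mulrACA.
Qed.

(* The one-dimensional representation mu (x) nu of the Borel subgroup.         *)
Definition borel_tensor := MxRepresentation borel_tensor_mx_repr.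

(* The principal series representation attached to mu and nu.                  *)
Definition principal_series :
    mx_representation algC 'GL_2[F] (\sum_(i < #|rcosets borel 'GL_2[F]|) 1)%N :=
  induced_repr (subsetT borel) borel_tensor.

End TensorCharacter.

End Borel.

(* Main.v *)
(* Write psi for mu (x) nu, psi_w for nu (x) mu, so that chi = Ind psi.      *)
(* Since psi is linear, Omega psi is the sum of its Galois conjugates, and   *)
(* Pi affords the sum of their induced characters. The multiplicity of chi   *)
(* in this rational character is, by Mackey's formula for the two double     *)
(* cosets of B, the number of Galois conjugates of psi in {psi, psi_w}: it   *)
(* is 2 if an automorphism swaps mu and nu, i.e., if (m/d)^2 = (n/d)^2 mod   *)
(* M, and 1 otherwise. By Galois invariance Pi affords 1 or 2 times the sum  *)
(* over the Galois orbit of chi.                                             *)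
(*   A rational representation containing chi exactly once shows that chi    *)
(* has Schur index 1 and yields a rational representation affording Omega    *)
(* chi: cut out the isotypic components by the central idempotents of the    *)
(* group ring. In case (1) Pi itself will do. In case (2) mu and nu are      *)
(* nontrivial, and then the trivial character of the torus {diag(a, 1)}      *)
(* occurs exactly once in chi, so the permutation representation on its      *)
(* cosets does. Finally, rational representations with the same character    *)
(* are isomorphic over the rationals.                                        *)

Require Import Defs.
From mathcomp Require Import all_boot all_order all_algebra all_fingroup.
From mathcomp Require Import all_solvable all_field all_character.
From mathcomp Require Import zify.

Set Implicit Arguments.
Unset Strict Implicit.
Unset Printing Implicit Defensive.

Import GroupScope GRing.Theory Num.Theory.
Local Open Scope ring_scope.

(** * Galois conjugates of characters *)

(** Everything is reduced to multiplicities. If chi occurs exactly once in some rational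
    representation, then its Schur index is 1 ([schur_index_mult1]) and its Galois orbit sum is
    afforded over the rationals ([galois_orbit_repr]). Any rational representation affording an
    orbit sum is irreducible ([orbit_repr_irreducible]). The multiplicity of chi in Pi is computed
    by [cfdot_Ind_tensor]; [psi_w_orbitP] and [swap_autP] translate its value, 1 or 2, into the
    congruence, and [Ind_galois_orbit] shows that Pi affords that multiple of the orbit sum. When it
    is 2, [cfdot_torus_tensor] supplies a rational representation containing chi once, and
    [cfRepr_ratr_inj] turns equality of characters into an isomorphism. *)

Section CharacterFieldAutomorphisms.

Variables (gT : finGroupType) (G : {group gT}).
Implicit Types (phi : 'CF(G)) (u : {rmorphism algC -> algC}).

(** On the cyclic group generated by g, phi is a sum of linear characters; their values are roots of
    unity of order dividing that of g, all raised by u to the same power. *)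
Lemma aut_char_expg u phi g : phi \is a character -> g \in G ->
  exists k, u (phi g) = phi (g ^+ k)%g.
Proof.
move=> Nphi Gg; have sgG: <[g]> \subset G by rewrite cycle_subG.
have [z prim_z] := C_prim_root_exists (order_gt0 g).
have [k _ uz] := aut_prim_rootP u prim_z; exists k.
rewrite -!(cfResE _ sgG) ?mem_cycle ?cycle_id //.
have [r ->] := char_sum_irr (cfRes_char <[g]> Nphi).
rewrite !sum_cfunE rmorph_sum; apply: eq_bigr => i _.
have lin_i: 'chi_i \is a linear_char by rewrite irr_cyclic_lin ?cycle_cyclic.
rewrite lin_charX ?cycle_id //.
have /(prim_rootP prim_z)[j ->]: 'chi_i g ^+ #[g]%g = 1.
  by rewrite -lin_charX ?cycle_id // expg_order lin_char1.
by rewrite rmorphXn uz exprAC.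
Qed.

Local Notation Qn := (group_field G).
Local Notation QnC := (group_field_emb G).
Local Notation "''Q' ( phi )" := (char_field (group_field_emb G) phi).

Lemma mem_char_field (L : fieldExtType rat) (iota : {rmorphism L -> algC})
    phi g :
  g \in G -> preim_emb iota (phi g) \in char_field iota phi.
Proof.
by move=> Gg; apply: seqv_sub_adjoin; apply/imageP; exists g.
Qed.

Lemma Crat_of_fixed_by_aut (a : Qn) :
  (forall u, u (QnC a) = QnC a) -> QnC a \in Crat.
Proof.
move=> fix_a; have gal_Qn: galois 1 {:Qn}.
  rewrite /galois sub1v normalFieldf andbT; apply/separableP=> x _.
  apply: pcharf0_separable => p; rewrite -(pchar_num rat) !inE.
  by rewrite -(rmorph_nat (in_alg Qn)) fmorph_eq0.
have: a \in fixedField 'Gal({:Qn} / 1).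
  apply/fixedFieldP=> [|tau _]; first exact: memvf.
  have [u Du] := extend_algC_subfield_aut QnC tau.
  by apply: (fmorph_inj QnC); rewrite Du fix_a.
rewrite (galois_fixedField gal_Qn) => /vlineP[r ->].
by rewrite rmorphZ_num rmorph1 mulr1 Crat_rat.
Qed.

Lemma gal_conj_aut phi (tau : gal_of 'Q(phi)) : phi \is a character ->
  exists u, gal_conj tau = cfAut u phi.
Proof.
move=> Nphi; have [u Du] := extend_algC_subfield_aut QnC tau; exists u.
by apply/cfunP=> g; rewrite !cfunE /gal_conj_val Du group_field_embP.
Qed.

(** The restriction of u to the normal field [Qn] sends each value of phi to another value of phi,
    by [aut_char_expg], so it stabilizes Q(phi). *)
Lemma aut_gal_conj phi u : phi \is a character ->
  exists2 tau : gal_of 'Q(phi),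
    tau \in 'Gal('Q(phi) / 1) & gal_conj tau = cfAut u phi.
Proof.
move=> Nphi; have [nu Dnu] := restrict_aut_to_normal_num_field QnC u.
have hom_nu: kHom 1 {:Qn} (linfun nu).
  rewrite k1HomE; apply/ahom_inP.
  by split=> [a b|]; rewrite ?lfunE ?rmorphM ?rmorph1 //= !lfunE.
have aut_nu: kAut 1 'Q(phi) (linfun nu).
  rewrite kAutE (kHomSr (subvf _) hom_nu) /=.
  have [f Df] := kHom_to_AEnd hom_nu.
  rewrite (eq_in_limg (g := f)) => [|x _]; last by rewrite Df ?memvf.
  rewrite aimg_adjoin_seq aimg1; apply/Fadjoin_seqP; split=> [|x].
    exact: sub1v.
  case/mapP=> _ /imageP[g Gg ->] ->; rewrite -Df ?memvf // lfunE /=.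
  have [k Dk] := aut_char_expg u Nphi Gg.
  suffices ->: nu (preim_emb QnC (phi g)) = preim_emb QnC (phi (g ^+ k)%g).
    by rewrite mem_char_field ?groupX.
  by apply: (fmorph_inj QnC); rewrite Dnu !group_field_embP.
have [tau gal_tau Dtau] := kAut_to_gal aut_nu; exists tau => //.
apply/cfun_inP=> g Gg; rewrite !cfunE /gal_conj_val -Dtau ?mem_char_field //.
by rewrite lfunE Dnu group_field_embP.
Qed.

(** If two conjugates agree, then tau1 / tau2 fixes the generators of Q(phi). This makes the Galois
    sum in [Omega] a sum over the orbit without repetitions. *)
Lemma gal_conj_inj phi : phi \is a character ->
  {in 'Gal('Q(phi) / 1) &, injective (@gal_conj _ _ phi)}.
Proof.
move=> Nphi tau1 tau2 _ _ eq_tau; apply/eqP; rewrite eq_mulgV1; apply/eqP.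
set t := (tau1 * _)%g.
have /subvP sub: ('Q(phi) <= fixedField [set t])%VS.
  apply/Fadjoin_seqP; split=> [|_ /imageP[g Gg ->]]; first exact: sub1v.
  apply/fixedFieldP=> [|_ /set1P->]; first exact: mem_char_field.
  rewrite galM ?mem_char_field //.
  have ->: tau1 (preim_emb QnC (phi g)) = tau2 (preim_emb QnC (phi g)).
    apply: (fmorph_inj QnC).
    by have /cfunP/(_ g) := eq_tau; rewrite !cfunE.
  by rewrite -galM ?mem_char_field // mulgV gal_id.
apply/eqP/gal_eqP=> x /sub /mem_fixedFieldP[_ fix_x].
by rewrite gal_id fix_x ?set11.
Qed.

Definition galois_orbit (i : Iirr G) : {set Iirr G} :=
  [set cfIirr (gal_conj tau) | tau in 'Gal('Q('chi_i) / 1)].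

Lemma galois_orbitP i j :
  reflect (exists u, j = aut_Iirr u i) (j \in galois_orbit i).
Proof.
apply: (iffP imsetP) => [[tau _ ->]|[u ->]].
  have [u Du] := gal_conj_aut tau (irr_char i); exists u.
  by apply: irr_inj; rewrite aut_IirrE cfIirrE ?Du // cfAut_irr ?mem_irr.
have [tau gal_tau Dtau] := aut_gal_conj u (irr_char i); exists tau => //.
by rewrite Dtau.
Qed.

Lemma Omega_irr i :
  Omega 'chi_i = (schur_index 'chi_i)%:R *: \sum_(j in galois_orbit i) 'chi_j.
Proof.
have irr_conj (tau : gal_of 'Q('chi_i)) : gal_conj tau \in irr G.
  by have [u ->] := gal_conj_aut tau (irr_char i); rewrite cfAut_irr mem_irr.
rewrite /Omega /galois_orbit [in RHS]big_imset => [|t1 t2 gal1 gal2 eq_t].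
  by under [in RHS]eq_bigr do rewrite cfIirrE //.
have := congr1 (tnth (irr G)) eq_t.
by rewrite !cfIirrE //; apply: gal_conj_inj => //; apply: irr_char.
Qed.

End CharacterFieldAutomorphisms.

(** * Rational representations *)

Section IdempotentRepresentation.

Variables (K : fieldType) (gT : finGroupType) (G : {group gT}) (n : nat).
Variables (rG : mx_representation K G n) (E : 'M[K]_n).
Hypotheses (idemE : E *m E = E) (centE : centgmx rG E).

(* The action of G on the image of E: by idempotence, col_base E is a right   *)
(* inverse of row_base E.                                                     *)
Definition idem_mx (g : gT) := row_base E *m rG g *m col_base E.

Lemma row_col_base_idem : row_base E *m col_base E = 1%:M.
Proof.
apply: (row_full_inj (col_base_full E)).
apply: (row_free_inj (row_base_free E)).
by rewrite mulmx1 mulmxA mulmx_base -mulmxA mulmx_base idemE.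
Qed.

Lemma idem_mx_repr : mx_repr G idem_mx.
Proof.
split=> [|x y Gx Gy].
  by rewrite /idem_mx repr_mx1 mulmx1 row_col_base_idem.
have rowE: row_base E *m E = row_base E.
  by rewrite -[X in _ *m X = _](mulmx_base E) mulmxA row_col_base_idem mul1mx.
rewrite /idem_mx repr_mxM //.
(* Generalizing the bases hides the occurrences of E inside them from the rewriting below. *)
move: (row_base E) (col_base E) (mulmx_base E) rowE => r c defE rE.
rewrite -!mulmxA (mulmxA c r) defE (mulmxA _ E) -(centgmxP centE) //.
by rewrite -(mulmxA E) (mulmxA r E) rE.
Qed.
Definition idem_repr := MxRepresentation idem_mx_repr.

Lemma mxtrace_idem_repr g : \tr (idem_repr g) = \tr (rG g *m E).
Proof. by rewrite /= mxtrace_mulC mulmxA mulmx_base mxtrace_mulC. Qed.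

End IdempotentRepresentation.

(** * Isotypic components cut out by central idempotents *)

Section IsotypicComponent.

Variables (gT : finGroupType) (G : {group gT}).
Let aG := regular_repr algC G.
Let C'G := algC'G_pchar G.

Definition central_idem (S : {set Iirr G}) :=
  \sum_(i in S) Wedderburn_id (@socle_of_Iirr _ G i).

Variable S : {set Iirr G}.
Local Notation "''R_' i" := (Wedderburn_subring (@socle_of_Iirr _ G i)).
Local Notation "''e_' i" := (Wedderburn_id (@socle_of_Iirr _ G i)).

Let mem_ring i A : (A \in 'R_i)%MS -> (A \in group_ring algC G)%MS.
Proof.
move=> RiA; rewrite -(Wedderburn_sum_pchar (DecSocleType aG) C'G).
exact: submx_trans RiA (sumsmx_sup _ _ (submx_refl _)).
Qed.

Lemma central_idem_mem : (central_idem S \in group_ring algC G)%MS.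
Proof.
by rewrite linear_sum summx_sub // => i _; apply/mem_ring/Wedderburn_id_mem.
Qed.

Lemma central_idem_idem : central_idem S *m central_idem S = central_idem S.
Proof.
rewrite mulmx_suml; apply: eq_bigr => i Si; rewrite mulmx_sumr (bigD1 i) //=.
have [_ Rei idei _] := Wedderburn_is_id_pchar C'G (@socle_of_Iirr _ G i).
rewrite idei // big1 ?addr0 // => j /andP[_ neq_ji].
rewrite (Wedderburn_mulmx0 _ Rei (Wedderburn_id_mem _)) //.
by rewrite (inj_eq (can_inj (@socle_of_IirrK _ G))) eq_sym.
Qed.

Lemma central_idemC A : (A \in group_ring algC G)%MS ->
  central_idem S *m A = A *m central_idem S.
Proof.
move=> RA; rewrite mulmx_suml mulmx_sumr; apply: eq_bigr => i _.
have [_ Rei idei idie] := Wedderburn_is_id_pchar C'G (@socle_of_Iirr _ G i).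
have /andP[idl idr] := Wedderburn_ideal (@socle_of_Iirr _ G i).
rewrite -[LHS]idie; last exact: submx_trans (mem_mulsmx Rei RA) idr.
by rewrite -mulmxA idei //; apply: submx_trans (mem_mulsmx RA Rei) idl.
Qed.

(** Extended linearly to the group ring, ['chi_j] takes at e_i g the value ['chi_j g] if i = j, and
    0 otherwise. *)
Lemma xcfun_central_idem (phi : 'CF(G)) g : g \in G ->
  (phi.[central_idem S *m aG g])%CF =
    (\sum_(i in S) '[phi, 'chi_i] *: 'chi_i) g.
Proof.
move=> Gg; rewrite {1}[phi]cfun_sum_cfdot -xcfun_rE raddf_sum sum_cfunE.
rewrite [RHS]big_mkcond; apply: eq_bigr => j _ /=; rewrite xcfunZl.
have RSg := envelop_mx_id aG Gg.
rewrite mulmx_suml raddf_sum.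
rewrite (eq_bigr (fun i => 'chi_j g *+ (i == j))) => [|i _].
  case: ifP => Sj; rewrite -?big_mkcondr /=.
    rewrite cfunE (bigD1 j) //= eqxx big1 ?addr0 // => i /andP[_ /negPf->].
    by rewrite mulr0n.
  rewrite big1 ?mulr0 // => i Si; case: eqP Si => [->|_ _]; rewrite ?Sj //.
rewrite /=; have [-> | neq_ij] := eqVneq i j.
  by rewrite xcfun_mul_id ?xcfunG.
rewrite (xcfun_annihilate (j := i)) ?mulr0n // 1?eq_sym //.
have /andP[_ idr] := Wedderburn_ideal (@socle_of_Iirr _ G i).
exact: submx_trans (mem_mulsmx (Wedderburn_id_mem _) RSg) idr.
Qed.

Variables (K : fieldType) (iota : {rmorphism K -> algC}).

(** The coefficient of x in the idempotent of S is c(x^-1) / |G|, which lies in K; so its image E in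
    the representation is a matrix over K, and the image of E affords the S-part of the
    character. *)
Lemma isotypic_component n (rG : mx_representation K G n) (c : gT -> K) :
    {in G, forall g, iota (c g) = \sum_(i in S) 'chi_i 1%g * 'chi_i g} ->
  exists m (rS : mx_representation K G m),
    cfRepr (map_repr iota rS) =
      \sum_(i in S) '[cfRepr (map_repr iota rG), 'chi_i] *: 'chi_i.
Proof.
move=> Dc; pose rC := map_repr iota rG.
pose E := #|G|%:R^-1 *: \sum_(x in G) c x^-1%g *: rG x.
have DE: map_mx iota E = gring_op rC (central_idem S).
  rewrite map_mxZ fmorphV rmorph_nat raddf_sum.
  rewrite /central_idem [gring_op _ _]raddf_sum /=.
  under [RHS]eq_bigr do rewrite Wedderburn_id_expansion linearZ linear_sum /=.
  rewrite -scaler_sumr; congr (_ *: _); rewrite exchange_big /=.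
  apply: eq_bigr => x Gx; rewrite map_mxZ Dc ?groupV // scaler_suml.
  by apply: eq_bigr => i _; rewrite linearZ /= gring_opG.
have inj_iota m1 m2: injective (@map_mx _ _ iota m1 m2).
  by apply: map_mx_inj; apply: fmorph_inj.
have idemE: E *m E = E.
  apply: inj_iota; rewrite map_mxM !DE -gring_opM ?central_idem_mem //.
  by rewrite central_idem_idem.
have centE: centgmx rG E.
  apply/centgmxP=> g Gg; apply: inj_iota; rewrite !map_mxM DE.
  have RSg := envelop_mx_id aG Gg.
  rewrite -(map_reprE iota rG) -(gring_opG rC Gg).
  by rewrite -!gring_opM ?central_idem_mem // central_idemC.
exists (\rank E), (idem_repr idemE centE); apply/cfun_inP=> g Gg.
rewrite cfunE Gg map_reprE trace_map_mx mxtrace_idem_repr -trace_map_mx.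
rewrite map_mxM mxtrace_mulC DE -(map_reprE iota rG) -(gring_opG rC Gg).
by rewrite -gring_opM ?envelop_mx_id // -xcfun_repr xcfun_central_idem.
Qed.

End IsotypicComponent.

(** * Descent of isomorphisms to the rationals *)

Section RationalSpecialization.

Lemma nat_nonroot (K : numDomainType) (p : {poly K}) :
  p != 0 -> exists k, p.[k%:R] != 0.
Proof.
move=> nz_p; pose s := [seq k%:R : K | k <- iota 0 (size p)].
have [root_p|/allPn[_ /mapP[k _ ->] nz_pk]] := boolP (all (root p) s).
  have uniq_s: uniq s.
    by rewrite map_inj_uniq ?iota_uniq //; apply/mulrIn/oner_neq0.
  by have := max_poly_roots nz_p root_p uniq_s; rewrite size_map size_iota ltnn.
by exists k.
Qed.

(** The coefficients are replaced one at a time: the determinant is a polynomial in each of them,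
    nonzero at the given value, hence nonzero at some natural number. The matrix B absorbs the terms
    not yet treated. *)
Lemma nat_det_neq0 (K : numFieldType) n (I : eqType) (s : seq I)
    (A : I -> 'M[K]_n) (c : I -> K) (B : 'M[K]_n) :
    uniq s -> \det (B + \sum_(i <- s) c i *: A i) != 0 ->
  exists k : I -> nat, \det (B + \sum_(i <- s) (k i)%:R *: A i) != 0.
Proof.
elim: s B => [|a s IHs] B /=.
  by rewrite big_nil => _ ?; exists (fun=> 0%N); rewrite big_nil.
rewrite big_cons addrA => /andP[s'a Us] /(IHs _ Us)[k].
set C := \sum_(i <- s) _ => nz_det.
pose p := \det (map_mx polyC (B + C) + 'X *: map_mx polyC (A a)).
have Dp x: p.[x] = \det (B + C + x *: A a).
  rewrite -[LHS]/(horner_eval x p) -det_map_mx; congr (\det _).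
  by apply/matrixP=> i j; rewrite !mxE /= /horner_eval !hornerE.
have /nat_nonroot[m nz_pm]: p != 0.
  by apply: contraNneq nz_det => p0; rewrite addrAC -Dp p0 horner0.
exists (fun i => if i == a then m else k i); rewrite big_cons eqxx.
rewrite (eq_big_seq (fun i => (k i)%:R *: A i)) => [|i s_i].
  by rewrite -/C addrCA addrC -Dp.
by case: eqP s'a => // <-; rewrite s_i.
Qed.

Variables (gT : finGroupType) (G : {group gT}).

Lemma cfRepr_ratr_inj n1 n2 (r1 : mx_representation rat G n1)
    (r2 : mx_representation rat G n2) :
    cfRepr (map_repr ratr r1) = cfRepr (map_repr ratr r2) ->
  mx_rsim r1 r2.
Proof.
move=> /cfRepr_inj[B eq_n]; case: _ / eq_n in r2 B * => freeB hB.
(* Averaging over G makes every matrix an intertwiner; B is a combination of  *)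
(* the averaged elementary matrices A, which are rational, and by             *)
(* nat_det_neq0 one with integer coefficients is also invertible.             *)
pose A (ij : 'I_n1 * 'I_n1) :=
  \sum_(x in G) r1 x^-1%g *m delta_mx ij.1 ij.2 *m r2 x.
have homA ij x : x \in G -> r1 x *m A ij = A ij *m r2 x.
  move=> Gx; rewrite mulmx_sumr mulmx_suml (reindex_inj (mulIg x)) /=.
  apply: eq_big => [y|y]; rewrite groupMr // => Gy.
  rewrite !mulmxA -repr_mxM ?groupV ?groupM // invMg mulKVg -mulmxA.
  by rewrite repr_mxM ?mulmxA.
pose AC ij := map_mx (ratr : rat -> algC) (A ij).
have DB: #|G|%:R *: B = \sum_ij B ij.1 ij.2 *: AC ij.
  have ->: #|G|%:R *: B =
      \sum_(x in G) map_repr ratr r1 x^-1%g *m B *m map_repr ratr r2 x.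
    rewrite scaler_nat -sumr_const; apply: eq_bigr => x Gx.
    by rewrite -mulmxA -hB // mulmxA -repr_mxM ?groupV // mulVg repr_mx1 mul1mx.
  under [RHS]eq_bigr do rewrite /AC raddf_sum scaler_sumr.
  rewrite exchange_big /=; apply: eq_bigr => x Gx.
  rewrite {1}[B]matrix_sum_delta pair_bigA /= mulmx_sumr mulmx_suml.
  apply: eq_bigr => ij _.
  by rewrite -scalemxAr -scalemxAl !map_mxM map_delta_mx.
have [k nz_det]: exists k : 'I_n1 * 'I_n1 -> nat,
    \det (0 + \sum_(ij <- index_enum _) (k ij)%:R *: AC ij) != 0.
  apply: (@nat_det_neq0 _ _ _ _ _ (fun ij => B ij.1 ij.2)).
    exact: index_enum_uniq.
  rewrite add0r -DB detZ mulf_neq0 ?expf_neq0 ?neq0CG //.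
  by rewrite -unitfE -[_ \is a _]row_free_unit.
exists (\sum_ij (k ij)%:R *: A ij) => [//||x Gx].
  rewrite row_free_unit unitmxE unitfE.
  rewrite -(fmorph_eq0 (ratr : rat -> algC)) -det_map_mx raddf_sum.
  rewrite add0r in nz_det; congr (\det _ != 0): nz_det.
  by apply: eq_bigr => ij _; rewrite /= map_mxZ rmorph_nat.
rewrite mulmx_sumr mulmx_suml; apply: eq_bigr => ij _.
by rewrite -scalemxAr homA // scalemxAl.
Qed.

End RationalSpecialization.

(** * Galois orbits in rational representations *)

Section RationalCharacters.

Variables (gT : finGroupType) (G : {group gT}).

Lemma galois_orbit_refl (i : Iirr G) : i \in galois_orbit i.
Proof.
apply/galois_orbitP; exists idfun; apply: irr_inj.
by rewrite aut_IirrE; apply/cfunP=> x; rewrite cfunE.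
Qed.

Lemma aut_galois_orbit u (i j : Iirr G) :
  j \in galois_orbit i -> aut_Iirr u j \in galois_orbit i.
Proof.
case/galois_orbitP=> v ->; apply/galois_orbitP; exists (u \o v).
by apply: irr_inj; rewrite !aut_IirrE; apply/cfunP=> x; rewrite !cfunE.
Qed.

Lemma imset_aut_galois_orbit u (i : Iirr G) :
  aut_Iirr u @: galois_orbit i = galois_orbit i.
Proof.
apply/eqP; rewrite eqEcard (card_imset _ (aut_Iirr_inj u)) leqnn andbT.
by apply/subsetP=> _ /imsetP[j Oj ->]; apply: aut_galois_orbit.
Qed.

Lemma galois_orbit_char1 (i j : Iirr G) :
  j \in galois_orbit i -> 'chi_j 1%g = 'chi_i 1%g.
Proof.
by case/galois_orbitP=> u ->; rewrite aut_IirrE cfAut_char1 ?irr_char.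
Qed.

(** Each automorphism permutes the orbit, so it fixes the sum, which lies in a Galois extension of
    the rationals. *)
Lemma galois_orbit_sum_rat (i : Iirr G) g :
  \sum_(j in galois_orbit i) 'chi_j g \in Crat.
Proof.
pose a := \sum_(j in galois_orbit i)
  preim_emb (group_field_emb G) ('chi_j g).
have Da: group_field_emb G a = \sum_(j in galois_orbit i) 'chi_j g.
  rewrite rmorph_sum; apply: eq_bigr => j _.
  by rewrite group_field_embP ?irr_char.
rewrite -Da; apply: Crat_of_fixed_by_aut => u; rewrite Da rmorph_sum.
rewrite -[in RHS](imset_aut_galois_orbit u) [in RHS]big_imset /=; last first.
  exact: in2W (aut_Iirr_inj u).
by apply: eq_bigr => j _; rewrite aut_IirrE cfunE.
Qed.

Variables (n : nat) (rG : mx_representation rat G n).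
Let phi := cfRepr (map_repr (ratr : rat -> algC) rG).

Lemma cfAut_ratr_repr u : cfAut u phi = phi.
Proof.
apply/cfun_inP=> g Gg.
by rewrite !cfunE Gg mulr1n map_reprE trace_map_mx fmorph_rat.
Qed.

Lemma cfdot_ratr_repr_orbit (i j : Iirr G) :
  j \in galois_orbit i -> '[phi, 'chi_j] = '[phi, 'chi_i].
Proof.
case/galois_orbitP=> u ->; rewrite -{1}(cfAut_ratr_repr u) aut_IirrE.
by rewrite cfdot_aut_irr aut_natr // Cnat_cfdot_char_irr ?cfRepr_char.
Qed.

(** Conjugates have equal degree and their sum has rational values, so the central idempotent of a
    whole orbit is rational. Its component contains each conjugate as often as ['chi_i], i.e.,
    once. *)
Lemma galois_orbit_repr (i : Iirr G) : '[phi, 'chi_i] = 1 ->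
  exists m (rS : mx_representation rat G m),
    cfRepr (map_repr ratr rS) = \sum_(j in galois_orbit i) 'chi_j.
Proof.
move=> phi_i; have [c Dc]: exists c : gT -> rat, forall g,
    ratr (c g) = 'chi_i 1%g * \sum_(j in galois_orbit i) 'chi_j g.
  pose c g := getCrat ('chi_i 1%g * \sum_(j in galois_orbit i) 'chi_j g).
  exists c => g; apply: getCratK; rewrite rpredM ?galois_orbit_sum_rat //.
  by rewrite irr1_degree rpred_nat.
have [g Gg|m [rS DrS]] :=
    @isotypic_component _ _ (galois_orbit i) _ ratr _ rG c.
  rewrite [LHS]Dc mulr_sumr; apply: eq_bigr => j Oj.
  by rewrite (galois_orbit_char1 Oj).
exists m, rS; rewrite DrS; apply: eq_bigr => j Oj.
by rewrite (cfdot_ratr_repr_orbit Oj) phi_i scale1r.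
Qed.

End RationalCharacters.

(** * Irreducibility of rational representations affording an orbit sum *)

Section OrbitIrreducibility.

Variables (gT : finGroupType) (G : {group gT}).

Lemma pchar_rat'G : ([pchar rat]^').-group G.
Proof. by apply/pgroupP=> p _; rewrite inE /= pchar_num. Qed.

Variables (n : nat) (rG : mx_representation rat G n) (i : Iirr G).
Hypothesis DrG :
  cfRepr (map_repr (ratr : rat -> algC) rG) = \sum_(j in galois_orbit i) 'chi_j.

Let cfE (E : 'M_n) (idemE : E *m E = E) (centE : centgmx rG E) :=
  cfRepr (map_repr (ratr : rat -> algC) (idem_repr idemE centE)).

Let idem_dual (E : 'M[rat]_n) :
  E *m E = E -> (1%:M - E) *m (1%:M - E) = 1%:M - E.
Proof. by move=> EE; rewrite mulmxBl mul1mx mulmxBr mulmx1 EE subrr subr0. Qed.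

Let cent_dual (E : 'M[rat]_n) : centgmx rG E -> centgmx rG (1%:M - E).
Proof.
move/centgmxP=> cE; apply/centgmxP=> x Gx.
by rewrite mulmxBl mulmxBr mul1mx mulmx1 cE.
Qed.

Lemma sum_idem_dual E (idemE : E *m E = E) (centE : centgmx rG E)
    (idemF : (1%:M - E) *m (1%:M - E) = 1%:M - E)
    (centF : centgmx rG (1%:M - E)) :
  cfE idemE centE + cfE idemF centF = \sum_(j in galois_orbit i) 'chi_j.
Proof.
rewrite -DrG; apply/cfun_inP=> g Gg; rewrite !cfunE Gg !mulr1n !map_reprE.
rewrite !trace_map_mx -rmorphD !mxtrace_idem_repr -raddfD -mulmxDr.
by rewrite addrC subrK mulmx1.
Qed.

(** On the orbit all multiplicities equal that of ['chi_i]; off the orbit, those for E and 1 - E are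
    natural numbers with sum 0. So the character vanishes, and its value at 1 is the rank of E. *)
Lemma idem_orbit0 E (idemE : E *m E = E) (centE : centgmx rG E) :
  '[cfE idemE centE, 'chi_i] = 0 -> E = 0.
Proof.
move=> Ei0; have idemF := idem_dual idemE; have centF := cent_dual centE.
have sumEF := sum_idem_dual idemE centE idemF centF.
have cfE0: cfE idemE centE = 0.
  rewrite [LHS]cfun_sum_cfdot big1 // => j _.
  have [Oj|O'j] := boolP (j \in galois_orbit i).
    by rewrite (cfdot_ratr_repr_orbit _ Oj) Ei0 scale0r.
  suffices ->: '[cfE idemE centE, 'chi_j] = 0 by rewrite scale0r.
  have: '[cfE idemE centE, 'chi_j] + '[cfE idemF centF, 'chi_j] = 0.
    rewrite -cfdotDl sumEF cfdot_suml big1 // => l Ol.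
    by rewrite cfdot_irr; case: eqP Ol O'j => // -> ->.
  have NE : cfE idemE centE \is a character := cfRepr_char _.
  have NF : cfE idemF centF \is a character := cfRepr_char _.
  move/eqP; rewrite paddr_eq0 ?natr_ge0 ?Cnat_cfdot_char_irr //.
  by case/andP=> /eqP.
have /cfunP/(_ 1%g) := cfE0; rewrite cfRepr1 cfunE => /eqP.
by rewrite pnatr_eq0 mxrank_eq0 => /eqP.
Qed.

(** By Maschke, a submodule U is the image of an equivariant projection E. As ['chi_i] occurs once
    in all, it is missing from the image of E or of 1 - E, and [idem_orbit0] makes that projection
    zero. *)
Lemma orbit_repr_irreducible : mx_irreducible rG.
Proof.
have orb_i: '[\sum_(j in galois_orbit i) 'chi_j, 'chi_i] = 1.
  rewrite cfdot_suml (bigD1 i) ?galois_orbit_refl //= cfnorm_irr big1 ?addr0 //.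
  by move=> j /andP[_ /negPf neq_ji]; rewrite cfdot_irr neq_ji.
have n_gt0: (0 < n)%N.
  rewrite lt0n; apply: contraTneq (oner_neq0 algC) => n0.
  have: cfRepr (map_repr (ratr : rat -> algC) rG) 1%g == 0.
    by rewrite cfRepr1 n0.
  rewrite char1_eq0 ?cfRepr_char // DrG => /eqP cf0.
  by rewrite -orb_i cf0 cfdot0l eqxx.
apply/mx_irrP; split=> // U modU nzU.
have [W modW sumUW dxUW] := mx_Maschke_pchar rG pchar_rat'G modU (submx1 U).
have UW0: (U :&: W = 0)%MS by apply/mxdirect_addsP.
pose E := proj_mx U W.
have idemE: E *m E = E by exact: proj_mx_proj.
have centE: centgmx rG E.
  apply/centgmxP=> x Gx.
  have := proj_mx_hom UW0 modU modW.
  rewrite sumUW => /hom_mxP/(_ x Gx).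
  by rewrite !mul1mx => <-.
have NE : cfE idemE centE \is a character := cfRepr_char _.
have idemF := idem_dual idemE; have centF := cent_dual centE.
have NF : cfE idemF centF \is a character := cfRepr_char _.
have := congr1 (cfdotr 'chi_i) (sum_idem_dual idemE centE idemF centF).
rewrite /cfdotr cfdotDl orb_i.
have /natrP[a Da] := Cnat_cfdot_char_irr i NE.
have /natrP[b Db] := Cnat_cfdot_char_irr i NF.
rewrite /cfE Da Db -natrD => /eqP; rewrite pnatr_eq1.
case: a Da => [/idem_orbit0 E0|a Da]; first last.
  rewrite addSn eqSS addn_eq0 => /andP[_ /eqP b0].
  move: Db; rewrite b0 => /idem_orbit0/subr0_eq E1.
  by rewrite -sub1mx -[1%:M]mulmx1 [X in _ *m X]E1 proj_mx_sub.
move: nzU; rewrite -(mulmx1 U).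
have := proj_mx_id UW0 (submx_refl U); rewrite -/E E0 mulmx0 => <-.
by rewrite mul0mx eqxx.
Qed.

End OrbitIrreducibility.

(** * Schur index one from multiplicity one *)

Section SchurIndex.

Variables (gT : finGroupType) (G : {group gT}).

Lemma realizable_in_degree_gt0 (psi : 'CF(G)) k :
  realizable_in_degree psi k -> (0 < k)%N.
Proof.
case=> L [iota [n [rG [_ ->]]]].
by rewrite divn_gt0 ?adim_gt0 // dimvS ?subvf.
Qed.

Lemma schur_index1 (psi : 'CF(G)) :
  realizable_in_degree psi 1 -> schur_index psi = 1%N.
Proof.
move=> real1; apply: classical_sets.xget_subset1; last first.
  move=> k l [real_k min_k] [real_l min_l].
  by apply/eqP; rewrite eqn_leq min_k ?min_l.
by split=> // k /realizable_in_degree_gt0.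
Qed.

(** The central idempotent of ['chi_i] has coefficients in L = Q(['chi_i]), so over L it cuts out of
    [rG] a representation affording ['chi_i] itself. *)
Lemma schur_index_mult1 n (rG : mx_representation rat G n) (i : Iirr G) :
  '[cfRepr (map_repr (ratr : rat -> algC) rG), 'chi_i] = 1 ->
  schur_index 'chi_i = 1%N.
Proof.
move=> mult1; apply: schur_index1.
pose Qn := group_field G; pose QnC := group_field_emb G.
pose E := char_field QnC 'chi_i; pose L := subvs_of E.
pose iota : {rmorphism L -> algC} := QnC \o vsval.
have /natrP[d Dd] := Cnat_irr1 i.
pose c g : L := d%:R * vsproj E (preim_emb QnC ('chi_i g)).
have iota_proj g : g \in G ->
    iota (vsproj E (preim_emb QnC ('chi_i g))) = 'chi_i g.
  move=> Gg.
  by rewrite /= vsprojK ?mem_char_field // group_field_embP ?irr_char.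
have [g Gg|m [rS DrS]] :=
    @isotypic_component _ _ [set i] _ iota _ (map_repr (in_alg L) rG) c.
  by rewrite big_set1 rmorphM rmorph_nat iota_proj // Dd.
exists L, iota, m, rS; split.
  rewrite DrS big_set1 -[RHS]scale1r -mult1; congr ('[_, _] *: _).
  apply/cfun_inP=> g Gg; rewrite !cfunE; congr (\tr _ *+ _).
  apply/matrixP=> r s; rewrite !mxE.
  exact: (fmorph_eq_rat (iota \o in_alg L)).
(* The character field is formed anew inside L; its image in [Qn] contains the generators of E, so
   it is all of L and the relative degree is 1. *)
suffices ->: char_field iota 'chi_i = {:L}%AS by rewrite divnn adim_gt0.
pose f := AHom (linfun_is_ahom (vsval : {lrmorphism L -> Qn})).
have Df x : f x = vsval x by rewrite /= lfunE.
have sub: (E <= f @: char_field iota 'chi_i)%VS.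
  rewrite aimg_adjoin_seq aimg1.
  apply/Fadjoin_seqP; split=> [|_ /imageP[g Gg ->]].
    exact: subv_adjoin_seq.
  apply: seqv_sub_adjoin; apply/mapP; exists (preim_emb iota ('chi_i g)).
    by apply/imageP; exists g.
  rewrite Df -{2}(iota_proj g Gg) iotaK vsprojK ?mem_char_field //.
apply/val_inj/eqP; rewrite eqEsubv subvf /=; apply/subvP=> x _.
have /(subvP sub)/memv_imgP[y CFy] := subvsP x.
by rewrite Df => /val_inj->.
Qed.

End SchurIndex.

(** * The character of an induced representation *)

Section InducedCharacter.

Variables (K : fieldType) (iota : {rmorphism K -> algC}).
Variables (gT : finGroupType) (G H : {group gT}) (n : nat).
Hypothesis sHG : H \subset G.
Variables (rH : mx_representation K H n) (phi : 'CF(H)).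
Hypothesis Dphi : {in H, forall h, iota (\tr (rH h)) = phi h}.

(** The summand phi(y g y^-1) of the induction formula is constant on right cosets of H, so the sum
    reduces to the coset representatives, which index the diagonal blocks. Zero blocks match the
    vanishing of phi outside H. *)
Lemma mxtrace_induced g :
  g \in G -> iota (\tr (induced_repr sHG rH g)) = 'Ind[G] phi g.
Proof.
move=> Gg; rewrite mxtrace_mxblock rmorph_sum cfIndE //.
pose F y := phi (g ^ y^-1)%g.
have -> : \sum_(y in G) phi (g ^ y)%g = \sum_(y in G) F y.
  rewrite (reindex_inj invg_inj) /=; apply: eq_bigl => y; exact: groupV.
rewrite (set_partition_big _ (rcosets_partition sHG)) /=.
rewrite (eq_bigr (fun A => #|H|%:R * F (repr A))) => [|A].
  rewrite -mulr_sumr mulKf ?neq0CG // [RHS]big_enum_val; apply: eq_bigr => i _.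
  rewrite /F /rcoset_rep /conjg invgK mulgA; case: ifP => [/Dphi//|notH].
  by rewrite mxtrace0 rmorph0 cfun0 ?notH.
case/rcosetsP=> x Gx ->.
have [h Hh ->] : exists2 h, h \in H & repr (H :* x) = (h * x)%g.
  by apply/rcosetP; apply: mem_repr_rcoset.
rewrite mulr_natl -[#|H|](card_rcoset _ x) -sumr_const; apply: eq_bigr => y.
case/rcosetP=> k Hk ->; rewrite /F !invMg !conjgM.
by rewrite (cfunJ _ _ (groupVr Hk)) (cfunJ _ _ (groupVr Hh)).
Qed.

End InducedCharacter.

(** * Characters induced from the Borel subgroup *)

Section BorelCharacters.

Variable F : finFieldType.
Local Notation G := 'GL_2[F]%G.
Local Notation B := (borel F).
Implicit Types (x y : {'GL_2[F]}) (a d : {unit F}) (b c : F).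

Lemma ord2P (i : 'I_2.-1.+1) : i = ord0 \/ i = ord_max.
Proof. by case: i => [[|[|//]] lti]; [left | right]; apply: val_inj. Qed.

Lemma GL2_inj x y :
  GLval x ord0 ord0 = GLval y ord0 ord0 ->
  GLval x ord0 ord_max = GLval y ord0 ord_max ->
  GLval x ord_max ord0 = GLval y ord_max ord0 ->
  GLval x ord_max ord_max = GLval y ord_max ord_max -> x = y.
Proof.
move=> e00 e01 e10 e11; apply: val_inj; apply/matrixP=> i j.
by have [->|->] := ord2P i; have [->|->] := ord2P j.
Qed.

Definition mx22 (p q r s : F) : 'M[F]_2.-1.+1 :=
  \matrix_(i, j) if i == ord0 then if j == ord0 then p else q
                 else if j == ord0 then r else s.

Lemma mx22_unit p q r s : p * s - q * r != 0 -> mx22 p q r s \is a GRing.unit.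
Proof.
move=> nz_det; change (mx22 p q r s \in unitmx); rewrite unitmxE unitfE.
rewrite (expand_det_row _ ord0) big_ord_recl big_ord1 /cofactor.
rewrite !det_mx11 !mxE /=.
by rewrite expr0 expr1 mul1r mulN1r mulrN.
Qed.

Definition upper a d b : {'GL_2[F]} :=
  insubd (1%g : {'GL_2[F]}) (mx22 (val a) b 0 (val d)).

(* The complement of B is the disjoint union of the cosets cell c * B.        *)
Definition cell c : {'GL_2[F]} := insubd (1%g : {'GL_2[F]}) (mx22 c 1 1 0).

Lemma upperE a d b : GLval (upper a d b) = mx22 (val a) b 0 (val d).
Proof.
have unitV (e : {unit F}) : val e != 0 by rewrite -unitfE (valP e).
by apply: insubdK; rewrite mx22_unit // mulr0 subr0 mulf_neq0.
Qed.

Lemma cellE c : GLval (cell c) = mx22 c 1 1 0.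
Proof.
by apply: insubdK; rewrite mx22_unit // mulr0 mulr1 sub0r oppr_eq0 oner_eq0.
Qed.

Lemma upper_borel a d b : upper a d b \in B.
Proof. by rewrite inE upperE mxE. Qed.

Lemma diag_unit_upper a d b :
  (diag_unit (upper a d b) ord0 = a) * (diag_unit (upper a d b) ord_max = d).
Proof.
by split; apply: val_inj; rewrite diag_unitK ?upper_borel // upperE mxE.
Qed.

Lemma upper_diag x : x \in B ->
  upper (diag_unit x ord0) (diag_unit x ord_max) (GLval x ord0 ord_max) = x.
Proof.
move=> Bx; have := Bx; rewrite inE => /eqP x10.
by apply: GL2_inj; rewrite upperE mxE //= ?x10 ?diag_unitK.
Qed.

Lemma big_borel (f : {'GL_2[F]} -> algC) :
  \sum_(x in B) f x = \sum_a \sum_d \sum_b f (upper a d b).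
Proof.
rewrite pair_bigA pair_bigA /=.
pose diag x := (diag_unit x ord0, diag_unit x ord_max, GLval x ord0 ord_max).
rewrite (reindex_onto (fun p => upper p.1.1 p.1.2 p.2) diag) => [|x Bx].
  apply: eq_bigl => -[[a d] b]; rewrite upper_borel /diag !diag_unit_upper.
  by rewrite upperE mxE /= eqxx.
exact: upper_diag.
Qed.

(** A matrix y outside B has a nonzero lower left entry; c is the ratio of the two entries of its
    first column, which right multiplication by B preserves. *)
Lemma big_cells (f : {'GL_2[F]} -> algC) :
  \sum_(y in ~: B) f y = \sum_c \sum_(z in B) f (cell c * z)%g.
Proof.
rewrite pair_big /=.
have cell_notB c z : z \in B -> (cell c * z)%g \notin B.
  move=> Bz; rewrite groupMr // inE cellE mxE /=. 
  exact: oner_neq0.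
have colE c z : z \in B -> 
   GLval (cell c * z)%g ord0 ord0 / GLval (cell c * z)%g ord_max ord0 = c.
  move=> Bz; have := Bz; rewrite inE => /eqP z10.
  rewrite !GL2_mulE cellE !mxE /= z10 !mulr0 !addr0 mul1r mulfK //.
  exact: borel_diag_neq0.
pose col y := GLval y ord0 ord0 / GLval y ord_max ord0.
rewrite (reindex_onto (fun p : F * {'GL_2[F]} => cell p.1 * p.2)%g
   (fun y => (col y, (cell (col y))^-1 * y)%g)) => [|y _]; last first.
  by rewrite mulKVg.
apply: eq_bigl => -[c z] /=; apply/andP/idP => [[notB /eqP[Dc Dz]] | Bz].
  have e10: GLval (cell c * z)%g ord_max ord0 = GLval z ord0 ord0.
    by rewrite GL2_mulE cellE !mxE /= mul1r mul0r addr0.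
  rewrite !inE e10 in notB; move: Dc; rewrite /col e10 GL2_mulE cellE !mxE /=.
  move/(canRL (mulfVK notB))/eqP; rewrite mul1r -subr_eq0 addrC addrA addNr.
  by rewrite add0r inE.
by rewrite inE cell_notB // /col colE // mulKg.
Qed.

(* The number of fixed points of x, acting on the projective line, other than *)
(* the point fixed by B.                                                      *)
Definition affine_fix x : nat :=
  #|[set c | GLval x ord0 ord0 * c + GLval x ord0 ord_max
               == c * GLval x ord_max ord_max]|.

(** The entries are read off from [cell c * y = x * cell c], which avoids inverting. The swap of the
    diagonal entries is what exchanges mu and nu. *)
Lemma conj_cell x c : x \in B ->
  let y := (x ^ cell c)%g in
  [/\ (y \in B) = (GLval x ord0 ord0 * c + GLval x ord0 ord_max
                     == c * GLval x ord_max ord_max),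
      GLval y ord0 ord0 = GLval x ord_max ord_max
    & GLval y ord_max ord_max = GLval x ord0 ord0].
Proof.
rewrite inE => /eqP x10 y.
have Dy i j : GLval (cell c * y)%g i j = GLval (x * cell c)%g i j.
  by rewrite /y conjgE !mulgA mulgV mul1g.
clearbody y.
have y00: GLval y ord0 ord0 = GLval x ord_max ord_max.
  have := Dy ord_max ord0; rewrite !GL2_mulE cellE !mxE /= x10.
  by rewrite mul1r !mul0r addr0 add0r mulr1.
have Dc : GLval y ord_max ord0 = GLval x ord0 ord0 * c + GLval x ord0 ord_max
                     - c * GLval x ord_max ord_max.
  have := Dy ord0 ord0; rewrite !GL2_mulE cellE !mxE /= y00 mul1r mulr1 => <-.
  by rewrite addrC addKr.
split=> //; first by rewrite inE Dc subr_eq0.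
have y01: GLval y ord0 ord_max = 0.
  have := Dy ord_max ord_max; rewrite !GL2_mulE cellE !mxE /= x10.
  by rewrite mul1r !mul0r mulr0 !addr0.
have := Dy ord0 ord_max; rewrite !GL2_mulE cellE !mxE /= y01.
by rewrite mulr0 mulr1 mul1r add0r mulr0 addr0.
Qed.

Local Notation tensor lin_mu lin_nu := (cfRepr (borel_tensor lin_mu lin_nu)).

Lemma tensorE (mu nu : 'CF([set: {unit F}]))
    (lin_mu : mu \is a linear_char) (lin_nu : nu \is a linear_char) x :
  x \in B ->
  tensor lin_mu lin_nu x = mu (diag_unit x ord0) * nu (diag_unit x ord_max).
Proof. by move=> Bx; rewrite cfunE Bx mulr1n mxtrace_scalar mulr1n. Qed.

Lemma tensor_lin_char (mu nu : 'CF([set: {unit F}]))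
    (lin_mu : mu \is a linear_char) (lin_nu : nu \is a linear_char) :
  tensor lin_mu lin_nu \is a linear_char.
Proof. by rewrite qualifE /= cfRepr_char cfRepr1 /=. Qed.

Section Tensor.

Variables mu nu : 'CF([set: {unit F}]).
Hypotheses (lin_mu : mu \is a linear_char) (lin_nu : nu \is a linear_char).

(** In the induction formula, conjugators in B give the first term. Each coset [cell c * B]
    contributes [psi_w x] when c is a fixed point of x, and 0 otherwise. *)
Lemma cfInd_tensorE x : x \in B ->
  'Ind[G] (tensor lin_mu lin_nu) x =
    tensor lin_mu lin_nu x + (affine_fix x)%:R * tensor lin_nu lin_mu x.
Proof.
move=> Bx; set psi := tensor lin_mu lin_nu.
rewrite cfIndE ?subsetT // (bigID (mem B)) /=.
have ->: \sum_(y in G | y \in B) psi (x ^ y)%g = #|B|%:R * psi x.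
  rewrite mulr_natl -sumr_const; apply: eq_big => [y|y /andP[_ By]].
    by rewrite inE.
  by rewrite cfunJ.
have ->: \sum_(y in G | y \notin B) psi (x ^ y)%g =
    #|B|%:R * ((affine_fix x)%:R * tensor lin_nu lin_mu x).
  rewrite (eq_bigl [in ~: B]) => [|y]; last by rewrite !inE.
  pose S := [set c | GLval x ord0 ord0 * c + GLval x ord0 ord_max
                       == c * GLval x ord_max ord_max].
  rewrite big_cells mulrCA mulr_natl -/(#|S|) -sumr_const [RHS]big_mkcond.
  apply: eq_bigr => c _.
  rewrite (eq_bigr (fun=> psi (x ^ cell c)%g)) => [|z Bz].
    rewrite sumr_const inE; have [<- y00 y11] := conj_cell c Bx.
    case: ifP => [By|/negbT notBy]; last by rewrite cfun0 ?mul0rn.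
    rewrite mulr_natl; congr (_ *+ _); rewrite /psi !tensorE // mulrC.
    by congr (nu _ * mu _); apply: val_inj; rewrite !diag_unitK.
  by rewrite conjgM cfunJ.
by rewrite -mulrDr mulKf ?neq0CG.
Qed.

End Tensor.

(** With the diagonal (a, d) held fixed, each c is a fixed point for exactly one b, namely cd - ac;
    so the average number of fixed points over b is 1. *)
Lemma sum_affine_fix (h : {unit F} -> {unit F} -> algC) :
  \sum_(x in B) (affine_fix x)%:R * h (diag_unit x ord0) (diag_unit x ord_max) =
    \sum_(x in B) h (diag_unit x ord0) (diag_unit x ord_max).
Proof.
rewrite !big_borel; apply: eq_bigr => a _; apply: eq_bigr => d _.
under eq_bigr do rewrite !diag_unit_upper.
under [RHS]eq_bigr do rewrite !diag_unit_upper.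
rewrite -mulr_suml sumr_const -[RHS]mulr_natl; congr (_ * _).
rewrite -natr_sum; congr (_%:R).
under eq_bigr do rewrite /affine_fix -sum1_card big_mkcond.
rewrite exchange_big -sum1_card; apply: eq_bigr => c _.
rewrite (bigD1 (c * val d - val a * c)) //= big1 => [|b neq_b].
  by rewrite inE upperE !mxE /= addrC subrK eqxx.
rewrite inE upperE !mxE /=; case: eqP => // Dc; case/eqP: neq_b.
by rewrite -Dc addrAC subrr add0r.
Qed.

Variables mu nu : 'CF([set: {unit F}]).
Hypotheses (lin_mu : mu \is a linear_char) (lin_nu : nu \is a linear_char).
Local Notation psi := (tensor lin_mu lin_nu).
Local Notation psi_w := (tensor lin_nu lin_mu).

(* Mackey's formula; the trivial double coset contributes the first term.     *)
Lemma cfdot_Ind_tensor (theta : 'CF(B)) (h : {unit F} -> {unit F} -> algC) :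
    {in B, forall x, theta x = h (diag_unit x ord0) (diag_unit x ord_max)} ->
  '['Ind[G] theta, 'Ind[G] psi] = '[theta, psi] + '[theta, psi_w].
Proof.
move=> Dtheta; rewrite -Frobenius_reciprocity !cfdotE -mulrDr -big_split /=.
congr (_ * _).
pose f a d := h a d * (nu a * mu d)^*.
rewrite (eq_bigr (fun x => theta x * (psi x)^* +
    (affine_fix x)%:R * f (diag_unit x ord0) (diag_unit x ord_max))) => [|x Bx].
  rewrite !big_split /= sum_affine_fix; congr (_ + _); apply: eq_bigr => x Bx.
  by rewrite tensorE // Dtheta.
rewrite cfResE ?subsetT // cfInd_tensorE // rmorphD rmorphM rmorph_nat mulrDr.
by rewrite mulrCA /f -Dtheta // (tensorE lin_nu).
Qed.

Lemma tensorC_neq : mu != nu -> psi != psi_w.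
Proof.
apply: contraNneq => eq_psi; apply/eqP/cfunP=> a.
have /cfunP/(_ (upper a 1 0)) := eq_psi; rewrite !tensorE ?upper_borel //.
by rewrite !diag_unit_upper !lin_char1 // !mulr1.
Qed.

Lemma cfInd_tensor_irr : mu != nu -> 'Ind[G] psi \in irr G.
Proof.
move=> neq_munu; rewrite irrEchar cfInd_char ?lin_charW ?tensor_lin_char //=.
have -> :=
  @cfdot_Ind_tensor psi (fun a d => mu a * nu d) (tensorE lin_mu lin_nu).
have /irrP[i Di] := lin_char_irr (tensor_lin_char lin_mu lin_nu).
have /irrP[j Dj] := lin_char_irr (tensor_lin_char lin_nu lin_mu).
have := tensorC_neq neq_munu; rewrite Di Dj cfnorm_irr cfdot_irr.
by rewrite (inj_eq irr_inj) => /negPf->; rewrite addr0.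
Qed.

Lemma sum_lin_char_neq1 (phi : 'CF([set: {unit F}])) :
  phi \is a linear_char -> phi != 1 -> \sum_a phi a = 0.
Proof.
move=> /lin_char_irr/irrP[i ->]; rewrite irr_eq1 => nz_i.
have := cfdot_irr i 0; rewrite (negPf nz_i) irr0 cfdotE => /eqP.
rewrite mulf_eq0 invr_eq0 (negPf (neq0CG _)) => /eqP S0; rewrite -[RHS]S0.
apply: eq_big => [a|a _]; first by rewrite inE.
by rewrite cfun1E inE conjC1 mulr1.
Qed.

Definition torus_set : {set {'GL_2[F]}} := [set upper a 1%g 0 | a : {unit F}].

Lemma torus_group_set : group_set torus_set.
Proof.
apply/group_setP; split=> [|_ _ /imsetP[a _ ->] /imsetP[a' _ ->]].
  by apply/imsetP; exists 1%g => //; apply: GL2_inj; rewrite upperE GL_1E !mxE.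
apply/imsetP; exists (a * a')%g => //; apply: GL2_inj;
  by rewrite GL2_mulE !upperE !mxE /= ?(mulr0, mul0r, addr0, add0r, mul1r).
Qed.
Canonical torus := Group torus_group_set.

Lemma upper_torus_inj : injective (fun a => upper a 1%g 0).
Proof.
move=> a a' /(congr1 (fun x : {'GL_2[F]} => diag_unit x ord0)).
by rewrite !diag_unit_upper.
Qed.

Lemma affine_fix_torus a :
  affine_fix (upper a 1%g 0) = (1 + #|F|.-1 * (a == 1%g))%N.
Proof.
have DE c : (c \in [set c | GLval (upper a 1%g 0) ord0 ord0 * c
      + GLval (upper a 1%g 0) ord0 ord_max
         == c * GLval (upper a 1%g 0) ord_max ord_max])
    = (a == 1%g) || (c == 0).
  rewrite inE upperE !mxE /= addr0 mulr1 -subr_eq0 -{2}(mul1r c) -mulrBl.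
  by rewrite mulf_eq0 subr_eq0.
rewrite /affine_fix (eq_card DE); case: eqP => _ /=.
  by rewrite muln1 add1n prednK // (cardD1 0).
by rewrite muln0 card1.
Qed.

(** On the torus the induced character restricts to mu + nu plus the regular character, by
    [affine_fix_torus]. Nontrivial mu and nu are orthogonal to 1, which occurs once in the regular
    character. *)
Lemma cfdot_torus_tensor :
  mu != 1 -> nu != 1 -> '['Ind[G, torus] 1, 'Ind[G] psi] = 1.
Proof.
move=> nt_mu nt_nu; rewrite cfdotC -cfdot_Res_l -[RHS]conjC1; congr (_^*).
rewrite cfdotE big_imset /=; last by move=> a a' _ _; apply: upper_torus_inj.
pose f a : algC := mu a + (nu a + (#|F|.-1 * (a == 1%g))%:R).
rewrite (eq_bigr f) => [|a _].
  rewrite !big_split /= !sum_lin_char_neq1 //.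
  rewrite !add0r -natr_sum (bigD1 1%g) //= eqxx muln1 big1 ?addn0 => [|a].
    have ->: #|F|.-1 = #|torus_set|.
      rewrite (card_imset _ upper_torus_inj) -card_finField_unit cardsT.
      by apply: eq_card.
    by rewrite mulVf ?neq0CG.
  by move/negPf->; rewrite muln0.
have Ta : upper a 1%g 0 \in torus by apply: imset_f.
rewrite cfResE ?subsetT // cfInd_tensorE ?upper_borel // cfun1E Ta conjC1 mulr1.
rewrite !tensorE ?upper_borel // !diag_unit_upper !lin_char1 // !mulr1.
rewrite affine_fix_torus natrD mulrDl mul1r; congr (_ + (_ + _)).
by case: eqP => [->|_]; rewrite ?lin_char1 ?mulr1 // muln0 mul0r.
Qed.

End BorelCharacters.

(** * The principal series *)

Section Congruences.

Local Open Scope nat_scope.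

(** A prime dividing both m and M divides n^2, hence n, against coprimality. *)
Lemma coprime_sqr_eqmod m n M : 0 < M -> coprime (gcdn m n) M ->
  m ^ 2 = n ^ 2 %[mod M] -> coprime m M.
Proof.
move=> M_gt0 co_mn eq2; apply: contraT => nco.
have g_gt1: 1 < gcdn m M by rewrite ltn_neqAle eq_sym nco gcdn_gt0 M_gt0 orbT.
have p_pr := pdiv_prime g_gt1; set p := pdiv _ in p_pr.
have /andP[pm pM]: (p %| m) && (p %| M) by rewrite -dvdn_gcd pdiv_dvd.
have pn: p %| n.
  have: p %| n ^ 2.
    by rewrite /dvdn -(modn_dvdm _ pM) -eq2 modn_dvdm // -/(dvdn _ _) dvdn_exp.
  by rewrite Euclid_dvdX // andbT.
have: p %| gcdn (gcdn m n) M by rewrite !dvdn_gcd pm pn.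
by rewrite (eqP co_mn) dvdn1 => /eqP p1; rewrite p1 in p_pr.
Qed.

(* Both m and n are units modulo M, and t = n / m.                            *)
Lemma swap_multiplier m n M : 0 < M -> coprime (gcdn m n) M ->
    m ^ 2 = n ^ 2 %[mod M] ->
  exists t, [/\ coprime t M, t * m = n %[mod M] & t * n = m %[mod M]].
Proof.
move=> M_gt0 co_mn eq2; have co_m := coprime_sqr_eqmod M_gt0 co_mn eq2.
have co_n: coprime n M.
  by apply: (coprime_sqr_eqmod M_gt0 (n := m)); rewrite // gcdnC.
have mE: m ^ (totient M).-1 * m = 1 %[mod M].
  by rewrite -expnSr prednK ?totient_gt0 // Euler_exp_totient.
exists (n * m ^ (totient M).-1); split.
- by rewrite coprimeMl co_n coprimeXl.
- by rewrite -mulnA -modnMmr mE modnMmr muln1.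
rewrite mulnAC -modnMml -eq2 modnMml (mulnC (m ^ 2)) -mulnn mulnA -modnMml mE.
by rewrite modnMml mul1n.
Qed.

(** Write m', n' for the quotients by d. An automorphism raising eps to the power t swaps the two
    roots iff tm' = n' and tn' = m' mod M, whence m'^2 = tm'n' = n'^2. Conversely, both roots are
    M-th roots of unity, so a multiplier t prime to M suffices. *)
Lemma aut_swap_rootsP N (eps : algC) m n
    (d := gcdn (gcdn m n) N) (M := N %/ d) :
  N.-primitive_root eps ->
  (exists u : {rmorphism algC -> algC},
     u (eps ^+ m) = eps ^+ n /\ u (eps ^+ n) = eps ^+ m)%R
  <-> (m %/ d) ^ 2 = (n %/ d) ^ 2 %[mod M].
Proof.
move=> prim_eps; have N_gt0 := prim_order_gt0 prim_eps.
have d_gt0: 0 < d by rewrite gcdn_gt0 N_gt0 orbT.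
have dN: d %| N := dvdn_gcdr _ _.
have /andP[dm dn]: (d %| m) && (d %| n) by rewrite -dvdn_gcd dvdn_gcdl.
have DN: N = M * d by rewrite divnK.
have M_gt0: 0 < M by rewrite divn_gt0 // dvdn_leq.
have Dm: m = m %/ d * d by rewrite divnK.
have Dn: n = n %/ d * d by rewrite divnK.
move: (m %/ d) (n %/ d) Dm Dn => m' n' Dm Dn.
have eqmod k l : (k * d == l * d %[mod N]) = (k == l %[mod M]).
  by rewrite DN -!muln_modl eqn_pmul2r.
have co: coprime (gcdn m' n') M.
  rewrite /coprime -(eqn_pmul2r d_gt0) mul1n !muln_gcdl -Dm -Dn -DN.
  exact/eqP.
have eqroot t k l :
    ((eps ^+ (k * d)) ^+ t == eps ^+ (l * d))%R = (t * k == l %[mod M]).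
  by rewrite -exprM (eq_prim_root_expr prim_eps) mulnC mulnA eqmod.
split=> [[u [um un]]|eq2].
  have [t _ ut] := aut_prim_rootP u prim_eps.
  move: um un; rewrite !rmorphXn !ut !(exprAC _ t) Dm Dn => /eqP.
  rewrite eqroot => /eqP tm /eqP; rewrite eqroot => /eqP tn.
  rewrite -!mulnn -[in LHS]modnMmr -tn modnMmr mulnCA mulnA.
  by rewrite -modnMml tm modnMml.
have [t [co_t tm tn]] := swap_multiplier M_gt0 co eq2.
have [u Du] := Qn_aut_exists co_t; exists u; rewrite Dm Dn.
have rootM k : ((eps ^+ (k * d)) ^+ M = 1)%R.
  rewrite -exprM -mulnA (mulnC d) -DN (mulnC k) exprM.
  by rewrite (prim_expr_order prim_eps) expr1n.
by rewrite !Du //; split; apply/eqP; rewrite eqroot ?tm ?tn.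
Qed.

End Congruences.

Section InducedOrbit.

Variables (gT : finGroupType) (G : {group gT}).

Lemma cfRepr_induced (K : fieldType) (iota : {rmorphism K -> algC})
    (H : {group gT}) (sHG : H \subset G) n (rH : mx_representation K H n) :
  cfRepr (map_repr iota (induced_repr sHG rH)) =
    'Ind[G] (cfRepr (map_repr iota rH)).
Proof.
apply/cfun_inP=> g Gg; rewrite cfunE Gg mulr1n map_reprE trace_map_mx.
apply: mxtrace_induced => // h Hh.
by rewrite cfunE Hh mulr1n map_reprE trace_map_mx.
Qed.

Lemma Omega_mult1 n (rG : mx_representation rat G n) (i : Iirr G) :
  '[cfRepr (map_repr ratr rG), 'chi_i] = 1 ->
  Omega 'chi_i = \sum_(j in galois_orbit i) 'chi_j.
Proof.
by move=> mult1; rewrite Omega_irr (schur_index_mult1 mult1) scale1r.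
Qed.

(** A linear character occurs exactly once in the regular representation, which is rational. *)
Lemma Omega_lin_char (i : Iirr G) : 'chi_i \is a linear_char ->
  Omega 'chi_i = \sum_(j in galois_orbit i) 'chi_j.
Proof.
move=> lin_i; apply: (@Omega_mult1 _ (regular_repr rat G)).
have ->: cfRepr (map_repr ratr (regular_repr rat G)) = cfReg G.
  rewrite -cfReprReg; apply/cfun_inP=> g Gg.
  by rewrite !cfunE map_regular_repr.
rewrite cfReg_sum cfdot_suml (bigD1 i) //= cfdotZl cfnorm_irr.
rewrite lin_char1 // mulr1 big1 ?addr0 // => j neq_ji.
by rewrite cfdotZl cfdot_irr (negPf neq_ji) mulr0.
Qed.

(** Induction commutes with automorphisms, so every constituent is conjugate to ['chi_l]; conjugates
    have equal multiplicities in a rational representation. *)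
Lemma Ind_galois_orbit (H : {group gT}) n (rG : mx_representation rat G n)
    (i : Iirr H) (l : Iirr G) :
    'chi_l = 'Ind[G] 'chi_i ->
    cfRepr (map_repr ratr rG) = 'Ind[G] (\sum_(j in galois_orbit i) 'chi_j) ->
  cfRepr (map_repr ratr rG) =
    '[cfRepr (map_repr ratr rG), 'chi_l] *: \sum_(j in galois_orbit l) 'chi_j.
Proof.
move=> Dl DrG; rewrite {1}[cfRepr _]cfun_sum_cfdot scaler_sumr [RHS]big_mkcond.
apply: eq_bigr => j _; case: ifP => [Oj|O'j].
  by rewrite (cfdot_ratr_repr_orbit _ Oj).
rewrite DrG linear_sum cfdot_suml big1 ?scale0r // => k /galois_orbitP[u ->].
rewrite aut_IirrE /= -cfAutInd -Dl -aut_IirrE cfdot_irr.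
case: eqP O'j => // <- /negP[]; apply/aut_galois_orbit/galois_orbit_refl.
Qed.

End InducedOrbit.

Section TrivialRepresentation.

Variables (gT : finGroupType) (H : {group gT}).

Lemma trivial_mx_repr (K : fieldType) : mx_repr H (fun=> 1%:M : 'M[K]_1).
Proof. by split=> // x y _ _; rewrite mulmx1. Qed.
Definition trivial_repr K := MxRepresentation (trivial_mx_repr K).

Lemma cfRepr_trivial (K : fieldType) (iota : {rmorphism K -> algC}) :
  cfRepr (map_repr iota (trivial_repr K)) = 1.
Proof.
apply/cfun_inP=> h Hh; rewrite cfunE Hh mulr1n map_reprE trace_map_mx cfun1E Hh.
by rewrite mxtrace1 rmorph1.
Qed.

End TrivialRepresentation.

Section PrincipalSeries.

Variables (F : finFieldType) (mu nu : 'CF([set: {unit F}])).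
Hypotheses (lin_mu : mu \is a linear_char) (lin_nu : nu \is a linear_char).
Hypothesis neq_munu : mu != nu.
Local Notation G := 'GL_2[F]%G.
Local Notation B := (borel F).
Local Notation psi := (cfRepr (borel_tensor lin_mu lin_nu)).
Local Notation psi_w := (cfRepr (borel_tensor lin_nu lin_mu)).

Lemma cfRepr_principal_series :
  cfRepr (principal_series lin_mu lin_nu) = 'Ind[G] psi.
Proof.
apply/cfun_inP=> g Gg; rewrite cfunE Gg mulr1n.
by apply: (mxtrace_induced (iota := idfun)) => // h Hh; rewrite cfunE Hh mulr1n.
Qed.

Lemma cfdot_Ind_orbit (i : Iirr B) : 'chi_i = psi ->
  '['Ind[G] (\sum_(j in galois_orbit i) 'chi_j), 'Ind[G] psi] =
    1 + (cfIirr psi_w \in galois_orbit i)%:R.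
Proof.
move=> Di; have /irrP[w Dw] := lin_char_irr (tensor_lin_char lin_nu lin_mu).
have -> : cfIirr psi_w = w by rewrite Dw irrK.
have orb_dot k : '[\sum_(j in galois_orbit i) 'chi_j, 'chi_k]
     = (k \in galois_orbit i)%:R.
  rewrite cfdot_suml; have [Ok|O'k] := boolP (k \in galois_orbit i).
    rewrite (bigD1 k) //= cfnorm_irr big1 ?addr0 // => j /andP[_ /negPf neq_j].
    by rewrite cfdot_irr neq_j.
  rewrite big1 // => j Oj; rewrite cfdot_irr; case: eqP Oj O'k => // -> -> //.
rewrite -(orb_dot w) -Dw.
(* The 1 is the multiplicity of psi in its own orbit sum; both sides become sums over the orbit,
   compared termwise by Mackey's formula. *)
have <-: (i \in galois_orbit i)%:R = 1 :> algC by rewrite galois_orbit_refl.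
rewrite -orb_dot Di.
rewrite linear_sum !cfdot_suml -big_split /=; apply: eq_bigr => j.
case/galois_orbitP=> u ->; rewrite aut_IirrE Di.
apply: (@cfdot_Ind_tensor _ _ _ _ _ _ (fun a d => u (mu a * nu d))) => x Bx.
by rewrite cfunE tensorE.
Qed.

(** Evaluation at diag(a, 1) and diag(1, a) separates the two tensor factors. *)
Lemma psi_w_orbitP (i : Iirr B) : 'chi_i = psi ->
  reflect (exists u : {rmorphism algC -> algC},
             cfAut u mu = nu /\ cfAut u nu = mu)
    (cfIirr psi_w \in galois_orbit i).
Proof.
move=> Di; apply: (iffP (galois_orbitP _ _)) => -[u].
  move/(congr1 (tnth (irr B))); rewrite aut_IirrE Di.
  rewrite cfIirrE ?lin_char_irr ?tensor_lin_char // => /cfunP Du; exists u.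
  split; apply/cfunP=> a; rewrite cfunE.
    have := Du (upper a 1%g 0).
    rewrite [cfAut _ _ _]cfunE !tensorE ?upper_borel //.
    by rewrite !diag_unit_upper !lin_char1 // !mulr1.
  have := Du (upper 1%g a 0).
  rewrite [cfAut _ _ _]cfunE !tensorE ?upper_borel //.
  by rewrite !diag_unit_upper !lin_char1 // !mul1r.
case=> Dmu Dnu; exists u; apply: irr_inj; rewrite aut_IirrE Di.
rewrite cfIirrE ?lin_char_irr ?tensor_lin_char //; apply/cfun_inP=> x Bx.
have umu a : u (mu a) = nu a by rewrite -Dmu cfunE.
have unu a : u (nu a) = mu a by rewrite -Dnu cfunE.
by rewrite [RHS]cfunE !tensorE // rmorphM umu unu.
Qed.

End PrincipalSeries.

Section GeneratorValues.

Variables (F : finFieldType) (q : nat).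
Variables (sigma : {unit F}) (gen_sigma : generator [set: {unit F}] sigma).
Variables (eps : algC) (prim_eps : (q - 1).-primitive_root eps).
Variables (m n : nat) (lt_nm : (n < m)%N) (le_mq : (m <= q - 2)%N).
Variables (mu nu : 'CF([set: {unit F}])).
Hypotheses (lin_mu : mu \is a linear_char) (lin_nu : nu \is a linear_char).
Hypotheses (mu_sigma : mu sigma = eps ^+ m) (nu_sigma : nu sigma = eps ^+ n).

Lemma lin_char_gen_inj (phi xi : 'CF([set: {unit F}])) :
  phi \is a linear_char -> xi \is a linear_char ->
  phi sigma = xi sigma -> phi = xi.
Proof.
move=> lin_phi lin_xi eq_sigma; apply/cfunP=> a.
have /cycleP[k ->]: a \in <[sigma]>%g by rewrite -(eqP gen_sigma) inE.
by rewrite !lin_charX ?inE // eq_sigma.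
Qed.

Lemma mu_neq_nu : mu != nu.
Proof.
have lt_mq : (m < q - 1)%N by move: lt_nm le_mq; clear; lia.
apply: contraTneq lt_nm => eq_munu; rewrite -leqNgt.
have := eq_prim_root_expr prim_eps m n.
rewrite -mu_sigma -nu_sigma eq_munu eqxx.
by rewrite !modn_small ?(ltn_trans lt_nm) // => /esym/eqP->.
Qed.

Lemma swap_autP (d := gcdn (gcdn m n) (q - 1)) :
  (exists u : {rmorphism algC -> algC}, cfAut u mu = nu /\ cfAut u nu = mu)
  <-> ((m %/ d) ^ 2 = (n %/ d) ^ 2 %[mod ((q - 1) %/ d)])%N.
Proof.
rewrite -(aut_swap_rootsP m n prim_eps) -mu_sigma -nu_sigma.
split=> -[u [Dmu Dnu]]; exists u.
  by split; [rewrite -Dmu | rewrite -Dnu]; rewrite cfunE.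
by split; apply: lin_char_gen_inj; rewrite ?cfAut_lin_char // cfunE.
Qed.

End GeneratorValues.

Theorem theorem4 (F : finFieldType) (q : nat) (Fq : #|F| = q)
    (sigma : {unit F}) (gen_sigma : generator [set: {unit F}] sigma)
    (eps : algC) (prim_eps : (q - 1).-primitive_root eps)
    (m n : nat) (lt_nm : (n < m)%N) (le_mq : (m <= q - 2)%N)
    (mu nu : 'CF([set: {unit F}]))
    (lin_mu : mu \is a linear_char) (lin_nu : nu \is a linear_char)
    (mu_sigma : mu sigma = eps ^+ m) (nu_sigma : nu sigma = eps ^+ n)
    (k : nat) (rhoB : mx_representation rat (borel F) k)
    (irr_rhoB : mx_irreducible rhoB)
    (rhoB_Omega : affords_rat rhoB (Omega (cfRepr (borel_tensor lin_mu lin_nu)))) :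
  let G := 'GL_2[F]%G in
  let chi : 'CF(G) := cfRepr (principal_series lin_mu lin_nu) in
  let d := gcdn (gcdn m n) (q - 1) in
  let M := ((q - 1) %/ d)%N in
  let Pi := induced_repr (subsetT (borel F) : borel F \subset G) rhoB in
  (((m %/ d) ^ 2 <> (n %/ d) ^ 2 %[mod M])%N ->
     mx_irreducible Pi /\ affords_rat Pi (Omega chi))
  /\
  (((m %/ d) ^ 2 = (n %/ d) ^ 2 %[mod M])%N ->
     exists (l : nat) (R : mx_representation rat G l),
       [/\ mx_irreducible R, affords_rat R (Omega chi)
         & mx_rsim Pi (dadd_grepr (Representation R) (Representation R))]).
Proof.
move=> G chi d M Pi.
have neq_munu := mu_neq_nu prim_eps lt_nm le_mq mu_sigma nu_sigma.
have [ib Dib] := irrP (lin_char_irr (tensor_lin_char lin_mu lin_nu)).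
have [ic Dic] := irrP (cfInd_tensor_irr lin_mu lin_nu neq_munu).
have Dchi : chi = 'chi_ic by rewrite /chi cfRepr_principal_series Dic.
pose phi := cfRepr (map_repr (ratr : rat -> algC) Pi).
have Dphi : phi = 'Ind[G] (\sum_(j in galois_orbit ib) 'chi_j).
  rewrite -Omega_lin_char -Dib ?tensor_lin_char // -rhoB_Omega.
  exact: cfRepr_induced.
have dot_phi : '[phi, 'chi_ic] =
    1 + (cfIirr (cfRepr (borel_tensor lin_nu lin_mu)) \in galois_orbit ib)%:R.
  by rewrite Dphi -Dic cfdot_Ind_orbit.
have phi_orbit : phi = '[phi, 'chi_ic] *: \sum_(j in galois_orbit ic) 'chi_j.
  by apply: Ind_galois_orbit Dphi; rewrite -Dib Dic.
have [swap_eq2 eq2_swap] :=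
  swap_autP gen_sigma prim_eps lin_mu lin_nu mu_sigma nu_sigma.
rewrite /affords_rat Dchi -/phi.
split=> [neq2|eq2].
  have mult1 : '[phi, 'chi_ic] = 1.
    rewrite dot_phi.
    by case: psi_w_orbitP => // [/swap_eq2/neq2|_] //; rewrite addr0.
  rewrite (Omega_mult1 mult1) {1}phi_orbit mult1 scale1r; split=> //.
  apply: (orbit_repr_irreducible (i := ic)).
  by rewrite -/phi phi_orbit mult1 scale1r.
have [u [Dmu Dnu]] := eq2_swap eq2.
have mult2 : '[phi, 'chi_ic] = 2%:R.
  by rewrite dot_phi; case: psi_w_orbitP => // [[]]; exists u.
(* The swapping automorphism fixes the trivial character, so if mu or nu were trivial they would be
   equal. *)
have nt_mu : mu != 1.
  by apply: contraNneq neq_munu => mu1; rewrite -Dmu mu1 cfAut_cfun1.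
have nt_nu : nu != 1.
  by apply: contraNneq neq_munu => nu1; rewrite -Dnu nu1 cfAut_cfun1.
pose Y := induced_repr (subsetT (torus F)) (trivial_repr (torus F) rat).
have Y1 : '[cfRepr (map_repr ratr Y), 'chi_ic] = 1.
  by rewrite cfRepr_induced cfRepr_trivial -Dic cfdot_torus_tensor.
have [l [R DR]] := galois_orbit_repr Y1; exists l, R.
rewrite (Omega_mult1 Y1); split=> //; first exact: orbit_repr_irreducible DR.
(* Both sides afford twice the orbit sum of chi, and the isomorphism descends to the rationals. *)
apply: cfRepr_ratr_inj; rewrite -/phi phi_orbit mult2 -DR.
apply/cfun_inP=> g Gg; rewrite !cfunE Gg !mulr1n !map_reprE !trace_map_mx.
by rewrite mxtrace_block rmorphD mulr_natl.
Qed.
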